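(* Let $G=(V,E)$ be a strongly regular graph with parameters $(n,\kappa,\lambda,\mu)$ and restricted eigenvalues $r\ge 0$ and $s<0$, and let $L$ be its Laplacian matrix. Let $k$ be an integer with $2\le k<n$. Then the optimal value of the semidefinite program $$\max\ \tfrac12\operatorname{tr}(LY)\quad\text{subject to}\quad \operatorname{diag}(Y)=u_n,\quad kY-J_n\succeq 0,\quad Y\ge 0,$$ where $Y$ ranges over real symmetric $n\times n$ matrices, is $$\min\left\{\frac{n(k-1)}{2k}(\kappa-s),\ \frac12\kappa n\right\}.$$
   Context: A $\kappa$-regular (finite, simple, undirected) graph on $n$ vertices is called strongly regular with parameters $(n,\kappa,\lambda,\mu)$ if it is not complete or edgeless and every two distinct vertices have $\lambda$ common neighbors if they are adjacent and $\mu$ common neighbors if they are not adjacent. Its adjacency matrix $A$ has exactly two distinct eigenvalues associated with eigenvectors orthogonal to the all-ones vector $u_n$; these are called the restricted eigenvalues and are denoted $r\ge 0$ and $s<0$. The Laplacian matrix is $L=\kappa I_n-A$. $\operatorname{diag}(Y)$ is the vector of diagonal entries of $Y$, $J_n$ is the $n\times n$ all-ones matrix, $M\succeq 0$ means $M$ is positive semidefinite, and $Y\ge 0$ means $Y$ is entrywise nonnegative. *)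

(* Defs.v *)
From mathcomp Require Export all_boot all_order all_algebra.
From mathcomp Require Export reals.

Set Implicit Arguments.
Unset Strict Implicit.
Unset Printing Implicit Defensive.

Import Order.TTheory GRing.Theory Num.Theory.
Local Open Scope ring_scope.

Definition simple_graph (V : finType) (e : rel V) : Prop :=
  symmetric e /\ irreflexive e.

Definition regular_graph (V : finType) (e : rel V) (kappa : nat) : Prop :=
  forall x, #|[set y | e x y]| = kappa.

Definition complete_graph (V : finType) (e : rel V) : Prop :=
  forall x y, x != y -> e x y.

Definition edgeless_graph (V : finType) (e : rel V) : Prop :=
  forall x y, ~~ e x y.

Definition common_neighbors (V : finType) (e : rel V) (x y : V) : {set V} :=
  [set z | e x z && e y z].

Record strongly_regular (V : finType) (e : rel V) (n kappa lambda mu : nat)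
    : Prop := StronglyRegular {
  srg_simple : simple_graph e;
  srg_card : #|V| = n;
  srg_regular : regular_graph e kappa;
  srg_not_complete : ~ complete_graph e;
  srg_not_edgeless : ~ edgeless_graph e;
  srg_adjacent : forall x y, x != y -> e x y ->
    #|common_neighbors e x y| = lambda;
  srg_nonadjacent : forall x y, x != y -> ~~ e x y ->
    #|common_neighbors e x y| = mu
}.

Section Matrices.
Variables (R : realType) (n : nat).

Definition all_ones : 'cV[R]_n := const_mx 1.

Definition adjacency (e : rel 'I_n) : 'M[R]_n := \matrix_(i, j) (e i j)%:R.

Definition laplacian (e : rel 'I_n) (kappa : nat) : 'M[R]_n :=
  kappa%:R%:M - adjacency e.

(* [eigenspace] consists of row vectors (v *m A = a *: v); for the symmetric
   matrices considered here this is the same as A *m v^T = a *: v^T. *)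
Definition restricted_eigenvalue (A : 'M[R]_n) (a : R) : Prop :=
  exists v : 'rV[R]_n,
    [/\ v != 0, (v <= eigenspace A a)%MS & v *m all_ones = 0].

Definition psd (M : 'M[R]_n) : Prop :=
  M^T = M /\ forall x : 'cV[R]_n, 0 <= (x^T *m M *m x) 0 0.

Record sdp_feasible (k : nat) (Y : 'M[R]_n) : Prop := SdpFeasible {
  sdp_sym : Y^T = Y;
  sdp_diag : \col_i Y i i = all_ones;
  sdp_psd : psd (k%:R *: Y - const_mx 1);
  sdp_ge0 : forall i j, 0 <= Y i j
}.

Definition sdp_objective (L Y : 'M[R]_n) : R := 2^-1 * \tr (L *m Y).

Definition sdp_optimal_value (L : 'M[R]_n) (k : nat) (v : R) : Prop :=
  (exists2 Y, sdp_feasible k Y & sdp_objective L Y = v) /\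
  (forall Y, sdp_feasible k Y -> sdp_objective L Y <= v).

End Matrices.

(* Main.v *)
(* In the algebra spanned by [I], [A] and [J], the matrices [A - s I - c J] with
   [c = (kappa - s) / n] and [F = r I - A + (kappa - r) / n J] are [r - s] times
   the projections onto the eigenspaces of [r] and [s].  Pairing [k Y - J] with
   [A - s I], a nonnegative combination of the first one and [J], bounds
   [tr (A Y)] from below and gives the first term of the minimum; the second
   term comes from [tr (A Y) >= 0].  Both are attained by matrices
   [Y = a F + c J]: in the first case [c = 1 / k] and [a] is fixed by the
   diagonal; in the second, [Y] is a multiple of [(1 + r) I] plus the adjacency
   matrix of the complement, so that [tr (A Y) = 0]. *)
Require Import Defs.
From mathcomp Require Import all_boot all_order all_algebra.
From mathcomp Require Import reals.
From mathcomp Require Import ring lra.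

Set Implicit Arguments.
Unset Strict Implicit.
Unset Printing Implicit Defensive.

Import Order.TTheory GRing.Theory Num.Theory.
Local Open Scope ring_scope.

(** * Positive semidefinite matrices and traces *)

(** E = t^-1 E^T E is a positive multiple of a Gram matrix. *)
Lemma psd_scaled_idempotent (R : realType) n (E : 'M[R]_n) (t : R) :
  E^T = E -> E *m E = t *: E -> 0 < t -> psd E.
Proof.
move=> symE EE t_gt0; split=> // x.
have ->: E = t^-1 *: (E^T *m E).
  by rewrite symE EE scalerA mulVf ?gt_eqF // scale1r.
rewrite -scalemxAr -scalemxAl mxE mulmxA -trmx_mul -mulmxA.
rewrite mulr_ge0 ?invr_ge0 ?(ltW t_gt0) // mxE.
by apply: sumr_ge0 => i _; rewrite mxE -expr2 sqr_ge0.
Qed.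

Lemma psdZ (R : realType) n (M : 'M[R]_n) (a : R) :
  0 <= a -> psd M -> psd (a *: M).
Proof.
move=> a_ge0 [symM posM]; split=> [|x]; first by rewrite linearZ /= symM.
by rewrite -scalemxAr -scalemxAl mxE mulr_ge0.
Qed.

Lemma psdD (R : realType) n (M N : 'M[R]_n) : psd M -> psd N -> psd (M + N).
Proof.
move=> [symM posM] [symN posN]; split=> [|x].
  by rewrite linearD /= symM symN.
by rewrite mulmxDr mulmxDl mxE addr_ge0.
Qed.

(** By cyclicity tr (E M) = t^-1 tr (E M E), and the diagonal entries of E M E are values of the
    quadratic form of M at the columns of E. *)
Lemma mxtrace_scaled_idempotent_psd_ge0 (R : realType) n (E M : 'M[R]_n)
    (t : R) :
  E^T = E -> E *m E = t *: E -> 0 < t -> psd M -> 0 <= \tr (E *m M).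
Proof.
move=> symE EE t_gt0 [_ posM].
have ->: \tr (E *m M) = t^-1 * \tr (E *m M *m E).
  by rewrite [\tr (_ *m E)]mxtrace_mulC mulmxA EE -scalemxAl mxtraceZ mulKf
    ?gt_eqF.
rewrite mulr_ge0 ?invr_ge0 ?(ltW t_gt0) //; apply: sumr_ge0 => i _.
have := posM (col i E); congr (0 <= _).
rewrite tr_col symE -row_mul mxE [RHS]mxE.
by apply: eq_bigr => j _; rewrite [row _ _ _ _]mxE [col _ _ _ _]mxE.
Qed.

Lemma const_mx1_mul (R : realType) n :
  (const_mx 1 : 'M[R]_n) *m const_mx 1 = n%:R *: (const_mx 1 : 'M[R]_n).
Proof.
apply/matrixP=> i j; rewrite !mxE mulr1.
under eq_bigr do rewrite !mxE mulr1.
by rewrite sumr_const card_ord.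
Qed.

Lemma mxtrace_const_mx1 (R : realType) n :
  \tr (const_mx 1 : 'M[R]_n) = n%:R.
Proof.
by rewrite /mxtrace; under eq_bigr do rewrite mxE; rewrite sumr_const card_ord.
Qed.

Lemma mxtrace_sdp_feasible (R : realType) n k (Y : 'M[R]_n) :
  sdp_feasible k Y -> \tr Y = n%:R.
Proof.
move=> [_ diagY _ _].
rewrite /mxtrace (eq_bigr (fun=> 1)) ?sumr_const ?card_ord // => i _.
by have /colP/(_ i) := diagY; rewrite !mxE.
Qed.

Lemma sdp_objective_laplacian (R : realType) n (e : rel 'I_n) kappa k
    (Y : 'M[R]_n) :
  sdp_feasible k Y ->
  sdp_objective (laplacian R e kappa) Y
    = 2^-1 * (kappa%:R * n%:R - \tr (adjacency R e *m Y)).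
Proof.
move=> feasY; rewrite /sdp_objective /laplacian mulmxBl mul_scalar_mx.
by rewrite raddfB /= mxtraceZ (mxtrace_sdp_feasible feasY).
Qed.

Lemma mxtrace_adjacency_mul_ge0 (R : realType) n (e : rel 'I_n)
    (Y : 'M[R]_n) :
  (forall i j, 0 <= Y i j) -> 0 <= \tr (adjacency R e *m Y).
Proof.
move=> Y_ge0; apply: sumr_ge0 => i _; rewrite mxE.
by apply: sumr_ge0 => j _; rewrite mxE mulr_ge0 ?ler0n.
Qed.

(** The general element of the Bose-Mesner algebra, in the basis I, A, J. *)
Definition srg_comb (R : realType) n (e : rel 'I_n) (x y z : R) : 'M[R]_n :=
  x%:M + y *: adjacency R e + z *: const_mx 1.

Lemma srg_combE (R : realType) n (e : rel 'I_n) (x y z : R) i j :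
  srg_comb e x y z i j = x *+ (i == j) + y * (e i j)%:R + z.
Proof. by rewrite !mxE mulr1. Qed.

(** * Relations satisfied by the adjacency matrix *)

Section StronglyRegular.
Variables (R : realType) (n kappa lambda mu : nat) (e : rel 'I_n).
Hypothesis srg : strongly_regular e n kappa lambda mu.

Let A := adjacency R e.
Let J : 'M[R]_n := const_mx 1.

Lemma adjacency_sym : A^T = A.
Proof.
by apply/matrixP=> i j; rewrite !mxE; case: (srg_simple srg) => ->.
Qed.

Lemma srg_comb_sym (x y z : R) : (srg_comb e x y z)^T = srg_comb e x y z.
Proof.
by rewrite /srg_comb !linearD !linearZ /= tr_scalar_mx adjacency_sym trmx_const.
Qed.

Lemma adjacency_mul_ones : A *m J = kappa%:R *: J.
Proof.
apply/matrixP=> i j; rewrite !mxE mulr1 -(srg_regular srg i) cardsE -sum1_card.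
rewrite natr_sum [RHS]big_mkcond /=; apply: eq_bigr => l _.
by rewrite !mxE mulr1 unfold_in; case: (e i l).
Qed.

Lemma ones_mul_adjacency : J *m A = kappa%:R *: J.
Proof.
by rewrite -[LHS]trmxK trmx_mul adjacency_sym trmx_const adjacency_mul_ones
  linearZ /= trmx_const.
Qed.

(** Entry (i, j) of A^2 counts common neighbors: kappa, lambda or mu. Since J also covers the
    diagonal and the edges, mu is subtracted from the other two coefficients. *)
Lemma adjacency_sqr :
  A *m A = srg_comb e (kappa%:R - mu%:R) (lambda%:R - mu%:R) mu%:R.
Proof.
have [sym irr] := srg_simple srg.
apply/matrixP=> i j; rewrite srg_combE.
have ->: (A *m A) i j = #|common_neighbors e i j|%:R.
  rewrite mxE cardsE -sum1_card natr_sum [RHS]big_mkcond /=.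
  apply: eq_bigr => l _; rewrite !mxE (sym l j) -natrM mulnb unfold_in.
  by case: (_ && _).
have [<-|ij] := eqVneq i j.
  have ->: common_neighbors e i i = [set y | e i y].
    by apply/setP=> l; rewrite !inE andbb.
  by rewrite (srg_regular srg) irr mulr0 addr0 subrK.
have [eij|eij] := boolP (e i j).
  by rewrite (srg_adjacent srg ij eij) mulr1 add0r subrK.
by rewrite (srg_nonadjacent srg ij eij) mulr0 !add0r.
Qed.

Lemma degree_gt0 : (0 < kappa)%N.
Proof.
rewrite lt0n; apply/eqP=> kappa0; apply: (srg_not_edgeless srg) => x y.
apply/negP=> exy; have := srg_regular srg x; rewrite kappa0 => /eqP.
by rewrite cards_eq0 => /eqP/setP/(_ y); rewrite !inE exy.
Qed.

Lemma mxtrace_adjacency_comb (x y z : R) :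
  \tr (A *m srg_comb e x y z) = kappa%:R * n%:R * (y + z).
Proof.
have [sym irr] := srg_simple srg.
rewrite /srg_comb !mulmxDr mul_mx_scalar -!scalemxAr adjacency_sqr.
rewrite adjacency_mul_ones !mxtraceD !mxtraceZ mxtraceD mxtraceD !mxtraceZ.
have ->: \tr A = 0 by rewrite /mxtrace big1 // => i _; rewrite mxE irr.
rewrite mxtrace_scalar mxtrace_const_mx1 -mulr_natr.
ring.
Qed.

(** An eigenvector orthogonal to the all-ones vector kills J, so applying it to [adjacency_sqr]
    leaves an equation in a alone. *)
Lemma restricted_eigenvalue_quadratic (a : R) :
  restricted_eigenvalue A a ->
  a ^+ 2 = kappa%:R - mu%:R + (lambda%:R - mu%:R) * a.
Proof.
move=> [v [v_neq0 /eigenspaceP vA vu]].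
have vJ : v *m J = 0.
  have ->: J = all_ones R n *m const_mx 1.
    by apply/matrixP=> i j; rewrite !mxE big_ord1 !mxE mulr1.
  by rewrite mulmxA vu mul0mx.
have := congr1 (mulmx v) adjacency_sqr.
rewrite mulmxA vA -scalemxAl vA /srg_comb !mulmxDr mul_mx_scalar -!scalemxAr.
rewrite vJ scaler0 addr0 vA !scalerA -scalerDl => /eqP.
rewrite -subr_eq0 -scalerBl scaler_eq0 (negbTE v_neq0) orbF subr_eq0.
by rewrite expr2 => /eqP.
Qed.

(** * Restricted eigenvalues and their scaled projections *)

Section RestrictedEigenvalues.
Variables r s : R.
Hypotheses (restr_r : restricted_eigenvalue A r) (r_ge0 : 0 <= r).
Hypotheses (restr_s : restricted_eigenvalue A s) (s_lt0 : s < 0).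
Hypothesis n_gt0 : (0 < n)%N.

Lemma restricted_gap_gt0 : 0 < r - s.
Proof. by rewrite subr_gt0 (lt_le_trans s_lt0). Qed.

(** Both r and s are roots of the same quadratic; subtract the two equations and cancel r - s. *)
Lemma restricted_sum : r + s = lambda%:R - mu%:R.
Proof.
have qr := restricted_eigenvalue_quadratic restr_r.
have qs := restricted_eigenvalue_quadratic restr_s.
by apply: (mulfI (lt0r_neq0 restricted_gap_gt0)); ring: qr qs.
Qed.

Lemma restricted_prod : r * s = mu%:R - kappa%:R.
Proof.
have qr := restricted_eigenvalue_quadratic restr_r.
move: qr; rewrite -restricted_sum; lra.
Qed.

(** Multiplying [adjacency_sqr] by J and comparing one entry gives the usual count of paths of
    length two; the sum and product of r and s put it in factored form. *)
Lemma srg_count : mu%:R * n%:R = (kappa%:R - s) * (kappa%:R - r).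
Proof.
have := congr1 (fun M => M *m J) adjacency_sqr.
rewrite -mulmxA adjacency_mul_ones -scalemxAr adjacency_mul_ones.
rewrite /srg_comb !mulmxDl mul_scalar_mx -!scalemxAl adjacency_mul_ones.
rewrite const_mx1_mul => /matrixP/(_ (Ordinal n_gt0) (Ordinal n_gt0)).
rewrite !mxE !mulr1 => eq_count.
have -> : mu%:R * n%:R
    = kappa%:R * kappa%:R - (kappa%:R - mu%:R)
      - (lambda%:R - mu%:R) * kappa%:R :> R by rewrite eq_count; ring.
rewrite -restricted_sum; ring: restricted_prod.
Qed.

Lemma degree_ge_restricted : r <= kappa%:R.
Proof.
have : 0 <= (kappa%:R - s) * (kappa%:R - r).
  by rewrite -srg_count mulr_ge0 ?ler0n.
by rewrite pmulr_rge0 ?subr_ge0 // subr_gt0 (lt_le_trans s_lt0) ?ler0n.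
Qed.

Lemma srg_comb_mul (x y z x' y' z' : R) :
  srg_comb e x y z *m srg_comb e x' y' z' =
  srg_comb e (x * x' - r * s * (y * y'))
    (x * y' + y * x' + (r + s) * (y * y'))
    (x * z' + z * x' + mu%:R * (y * y') + kappa%:R * (y * z' + z * y')
     + n%:R * (z * z')).
Proof.
have eqAA := adjacency_sqr; rewrite -restricted_sum in eqAA.
have eqrs : kappa%:R - mu%:R = - (r * s) by rewrite restricted_prod opprB.
rewrite eqrs in eqAA.
rewrite [in LHS]/srg_comb !(mulmxDl, mulmxDr) -!(scalemxAl, scalemxAr).
rewrite !(mul_mx_scalar, mul_scalar_mx) eqAA adjacency_mul_ones.
rewrite ones_mul_adjacency const_mx1_mul.
by apply/matrixP=> i j; rewrite !mxE; ring.
Qed.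

(** The coefficient of J is chosen so that the all-ones vector is killed. Leaving out the factor 1 /
    (r - s) keeps the coefficients simple. *)
Definition r_projector := srg_comb e (- s) 1 (- (kappa%:R - s) / n%:R).
Definition s_projector := srg_comb e r (-1) ((kappa%:R - r) / n%:R).

Lemma r_projector_sqr : r_projector *m r_projector = (r - s) *: r_projector.
Proof.
have nz : n%:R != 0 :> R by rewrite pnatr_eq0 -lt0n.
(* Once mu is eliminated, the claim is a rational identity in kappa, r, s and n. *)
have hmu : mu%:R = (kappa%:R - s) * (kappa%:R - r) / n%:R.
  by rewrite -srg_count mulfK.
rewrite srg_comb_mul hmu; apply/matrixP=> i j; rewrite !mxE.
by field.
Qed.

Lemma s_projector_sqr : s_projector *m s_projector = (r - s) *: s_projector.
Proof.
have nz : n%:R != 0 :> R by rewrite pnatr_eq0 -lt0n.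
have hmu : mu%:R = (kappa%:R - s) * (kappa%:R - r) / n%:R.
  by rewrite -srg_count mulfK.
rewrite srg_comb_mul hmu; apply/matrixP=> i j; rewrite !mxE.
by field.
Qed.

(** * Eigenvalue bound and feasible matrices *)

Lemma mxtrace_adjacency_feasible_ge k (Y : 'M[R]_n) : sdp_feasible k Y ->
  s * n%:R * (k%:R - 1) + kappa%:R * n%:R <= k%:R * \tr (A *m Y).
Proof.
move=> feasY; have trY := mxtrace_sdp_feasible feasY.
have psdY := sdp_psd feasY.
have nn : 0 < n%:R :> R by rewrite ltr0n.
have := mxtrace_scaled_idempotent_psd_ge0 (srg_comb_sym _ _ _)
  r_projector_sqr restricted_gap_gt0 psdY.
have := mxtrace_scaled_idempotent_psd_ge0 (trmx_const _ _ _)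
  (const_mx1_mul R n) nn psdY.
have c_ge0 : 0 <= (kappa%:R - s) / n%:R
  by rewrite divr_ge0 ?subr_ge0 ?ler0n ?(le_trans (ltW s_lt0)).
(* The multiple of J cancels the J part of [r_projector], leaving tr ((A - s I) (k Y - J)) >= 0. *)
move=> /(mulr_ge0 c_ge0) h1 h2; have {h1 h2} := addr_ge0 h1 h2.
rewrite /r_projector /srg_comb !mulmxDl -!scalemxAl !mxtraceD !mxtraceZ.
rewrite mul1r mulNr mulNr addrC subrK mul_scalar_mx mxtraceZ mulmxBr.
rewrite adjacency_mul_ones -scalemxAr !raddfB /= !mxtraceZ trY.
rewrite mxtrace_const_mx1 -/A => h.
by rewrite -subr_ge0; congr (0 <= _): h; ring.
Qed.

(** The bounds on a and c make k Y - J a nonnegative combination of [s_projector] and J; the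
    equation normalizes the diagonal, and the last inequality is nonnegativity on edges. Entries at
    non-adjacent pairs are then nonnegative because r <= kappa. *)
Lemma sdp_feasible_comb (k : nat) (a c : R) :
  (0 < k)%N -> 0 <= a -> k%:R^-1 <= c ->
  a * (r + (kappa%:R - r) / n%:R) + c = 1 ->
  0 <= a * (-1 + (kappa%:R - r) / n%:R) + c ->
  let Y := a *: s_projector + c *: J in
  sdp_feasible k Y /\
  sdp_objective (laplacian R e kappa) Y =
    2^-1 * (kappa%:R * n%:R * (a * (r + 1))).
Proof.
move=> k_gt0 a_ge0 c_ge diag1 adj_ge0 Y.
have [sym irr] := srg_simple srg.
have kr : 0 < k%:R :> R by rewrite ltr0n.
have YE : Y = srg_comb e (a * r) (- a) (a * ((kappa%:R - r) / n%:R) + c).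
  by apply/matrixP=> i j; rewrite !mxE; ring.
have feasY : sdp_feasible k Y.
  split.
  - by rewrite YE srg_comb_sym.
  - apply/colP=> i; rewrite mxE [RHS]mxE YE srg_combE eqxx irr -[RHS]diag1 mulr1n.
    rewrite mulr0n; ring.
  - have ->: k%:R *: Y - const_mx 1
        = (k%:R * a) *: s_projector + (k%:R * c - 1) *: J.
      by apply/matrixP=> i j; rewrite !mxE; ring.
    have kc : 0 <= k%:R * c - 1 by rewrite subr_ge0 mulrC -ler_pdivrMr ?div1r.
    apply: psdD; apply: psdZ => //.
    + by rewrite mulr_ge0 // ltW.
    + apply: (psd_scaled_idempotent _ s_projector_sqr restricted_gap_gt0).
      exact: srg_comb_sym.
    + apply: (psd_scaled_idempotent _ (const_mx1_mul R n)); last by rewrite ltr0n.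
      exact: trmx_const.
  - move=> i j; rewrite YE srg_combE.
    have r_le : 0 <= (kappa%:R - r) / n%:R.
      by rewrite divr_ge0 ?ler0n // subr_ge0 degree_ge_restricted.
    have c_ge0 : 0 <= c by apply: le_trans c_ge; rewrite invr_ge0 ltW.
    have [<-|ij] := eqVneq i j.
      by rewrite irr !mulr0n mulr0 addr0 mulr1n addrA -mulrDr addr_ge0 //
        mulr_ge0 // addr_ge0.
    rewrite mulr0n add0r; case: (e i j).
      by rewrite mulr1n; congr (0 <= _): adj_ge0; ring.
    by rewrite mulr0n mulr0 add0r addr_ge0 // mulr_ge0.
split=> //; rewrite (sdp_objective_laplacian _ _ feasY) YE mxtrace_adjacency_comb.
(* With 1 written as the diagonal entry of Y, subtracting the entry on an edge leaves a (r + 1). *)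
congr (_ * _); rewrite -[X in X - _]mulr1 -[X in _ * _ * X - _]diag1; ring.
Qed.

End RestrictedEigenvalues.
End StronglyRegular.

(** * The optimal value *)

Theorem theorem7 (R : realType) (n kappa lambda mu : nat) (e : rel 'I_n)
    (r s : R) (k : nat)
    (hG : strongly_regular e n kappa lambda mu)
    (hr : restricted_eigenvalue (adjacency R e) r) (hr0 : 0 <= r)
    (hs : restricted_eigenvalue (adjacency R e) s) (hs0 : s < 0)
    (hk2 : (2 <= k)%N) (hkn : (k < n)%N) :
  sdp_optimal_value (laplacian R e kappa) k
    (Num.min (n%:R * (k%:R - 1) / (2 * k%:R) * (kappa%:R - s))
             (2^-1 * kappa%:R * n%:R)).
Proof.
have k_gt0 : (0 < k)%N by apply: leq_trans hk2.
have n_gt0 : (0 < n)%N by apply: leq_trans hkn.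
have kr : 0 < k%:R :> R by rewrite ltr0n.
have k_ge2 : 2 <= k%:R :> R by rewrite ler_nat.
have nr : 1 <= n%:R :> R by rewrite ler1n.
have kap : 0 < kappa%:R :> R by rewrite ltr0n (degree_gt0 hG).
have r_le := degree_ge_restricted hG hr hr0 hs hs0 n_gt0.
have cnt := srg_count hG hr hr0 hs hs0 n_gt0.
have prd := restricted_prod hG hr hr0 hs hs0.
have muE : mu%:R = kappa%:R + r * s by rewrite prd; ring.
rewrite {}muE in cnt.
have feas := @sdp_feasible_comb R n kappa lambda mu e hG r s hr hr0 hs hs0
  n_gt0 k.
have nz : n%:R != 0 :> R by lra.
have kz : k%:R != 0 :> R by lra.
split; last first.
  move=> Y feasY; rewrite (sdp_objective_laplacian _ _ feasY) le_min.
  apply/andP; split; last first.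
    have := mxtrace_adjacency_mul_ge0 e (sdp_ge0 feasY); lra.
  have := mxtrace_adjacency_feasible_ge hG hr hr0 hs hs0 n_gt0 feasY.
  move=> h; rewrite -(ler_pM2l kr).
  have ->: k%:R * (n%:R * (k%:R - 1) / (2 * k%:R) * (kappa%:R - s))
    = 2^-1 * (n%:R * (k%:R - 1) * (kappa%:R - s)) by field.
  lra.
case: leP => [le_min|lt_min].
  (* D is the diagonal entry of [s_projector], so c = 1 / k forces a = (1 - 1 / k) / D. *)
  set D := r + (kappa%:R - r) / n%:R.
  have D_gt0 : 0 < D.
    have ->: D = (r * (n%:R - 1) + kappa%:R) / n%:R by rewrite /D; field.
    by rewrite divr_gt0 ?ltr_wpDl ?mulr_ge0 //; lra.
  have Dz : D != 0 by rewrite gt_eqF.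
  (* This is tr (A F) = s tr F divided by n, with F the matrix [s_projector]; here it follows from
     the count [cnt]. *)
  have DE : kappa%:R * (-1 + (kappa%:R - r) / n%:R) = s * D.
    apply: (mulfI nz); rewrite /D.
    transitivity (kappa%:R * (- n%:R + (kappa%:R - r))); first by field.
    transitivity (s * (n%:R * r + (kappa%:R - r))); last by field.
    move: cnt; lra.
  have DE' : kappa%:R * (r + 1) = (kappa%:R - s) * D.
    by rewrite mulrBl -DE /D; field.
  have inv_le1 : k%:R^-1 <= 1 :> R by rewrite invf_le1 //; lra.
  have [] := feas ((1 - k%:R^-1) / D) k%:R^-1 k_gt0.
  - by rewrite divr_ge0 ?subr_ge0 // ltW.
  - by [].
  - by rewrite divfK // subrK.
  (* Scaled by kappa and k, the entry on an edge becomes s (k - 1) + kappa; its nonnegativity is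
     exactly the case assumption [le_min]. *)
  - rewrite -(pmulr_rge0 _ kap) mulrDr mulrCA DE mulrCA divfK // -(pmulr_rge0 _ kr).
    have ->: k%:R * (s * (1 - k%:R^-1) + kappa%:R * k%:R^-1)
        = s * (k%:R - 1) + kappa%:R by field.
    move: le_min.
    have ->: n%:R * (k%:R - 1) / (2 * k%:R) * (kappa%:R - s)
      = (2^-1 * n%:R / k%:R) * ((k%:R - 1) * (kappa%:R - s)) by field.
    have ->: 2^-1 * kappa%:R * n%:R
      = (2^-1 * n%:R / k%:R) * (k%:R * kappa%:R) :> R by field.
    rewrite ler_pM2l; last by rewrite divr_gt0 //; lra.
    lra.
  move=> feasY objY; eexists; first exact: feasY.
  rewrite objY.
  transitivity (2^-1 * n%:R * (1 - k%:R^-1) / D * (kappa%:R * (r + 1))).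
    by field; rewrite Dz.
  by rewrite DE'; field; rewrite Dz kz.
have r1 : 0 < 1 + r by lra.
have r1z : r + 1 != 0 by lra.
(* This a makes the objective kappa n / 2, and this c makes the entries on edges vanish. *)
have [] := feas (r + 1)^-1 ((r + 1)^-1 * (1 - (kappa%:R - r) / n%:R)) k_gt0.
- by rewrite invr_ge0; lra.
- have ->: (r + 1)^-1 * (1 - (kappa%:R - r) / n%:R)
      = (n%:R + r - kappa%:R) / ((r + 1) * n%:R) by field; rewrite ?nz ?r1z.
  rewrite ler_pdivlMr; last by rewrite mulr_gt0 //; lra.
  rewrite mulrC ler_pdivrMr //.
  have ks : 0 < kappa%:R - s by lra.
  rewrite -(ler_pM2l ks).
  (* By [cnt], the condition 1 / k <= c reduces to kappa - s <= - s k, which [lt_min] provides. *)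
  have eqc : (kappa%:R - s) * ((n%:R + r - kappa%:R) * k%:R)
     = (- s * k%:R) * ((r + 1) * n%:R).
    by have /= := congr1 ( *%R k%:R) cnt; lra.
  rewrite eqc ler_pM2r; last by rewrite mulr_gt0 //; lra.
  move: lt_min.
  have ->: n%:R * (k%:R - 1) / (2 * k%:R) * (kappa%:R - s)
    = (2^-1 * n%:R / k%:R) * ((k%:R - 1) * (kappa%:R - s)) by field.
  have ->: 2^-1 * kappa%:R * n%:R
    = (2^-1 * n%:R / k%:R) * (k%:R * kappa%:R) :> R by field.
  rewrite ltr_pM2l; last by rewrite divr_gt0 //; lra.
  lra.
- by field; rewrite ?nz ?r1z.
- by rewrite -mulrDr addrACA addNr subrr addr0 mulr0.
move=> feasY objY; eexists; first exact: feasY.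
by rewrite objY; field.
Qed.
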